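(* Let $D_0$ be the edge-ordered graph on the four vertices $a,b,v,w$ with exactly the five edges $ab,av,aw,bw,bv$, ordered by $l(ab)<l(av)<l(aw)<l(bw)<l(bv)$. Then \[ssat_m(n,D_0)\ \le\ sat_m(n,D_0)=O\left(n\,\frac{\log n}{\log\log n}\right).\]
   Context: An edge-ordered graph is a finite simple graph together with a linear order on its edge set given by an injective labeling $l$ to $\mathbb{N}$ or $\mathbb{R}$. An edge-ordered graph $H$ contains $G$ (has a copy of $G$) if $G$ is isomorphic, by an isomorphism respecting the edge-order, to a subgraph of $H$ with the induced order; otherwise $H$ is $G$-free. $ssat_m(n,G)$ is the minimum number of edges in an edge-ordered graph $H$ on $n$ vertices such that adding to $H$ any missing edge, inserted at the beginning of the linear order (i.e. with a label smaller than all labels of $H$), creates a new copy of $G$ (one using the added edge). $sat_m(n,G)$ is defined in the same way with the additional requirement that $H$ is $G$-free. Asymptotic notation is for $n\to\infty$. *)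

(* Defs.v *)
From HB Require Import structures.
From mathcomp Require Export all_boot all_order all_algebra.
From mathcomp Require Export all_classical all_reals all_analysis.
Export Order.TTheory GRing.Theory Num.Theory.
Export numFieldNormedType.Exports.

Set Implicit Arguments.
Unset Strict Implicit.
Unset Printing Implicit Defensive.

Local Open Scope classical_set_scope.
Local Open Scope ring_scope.

(* Edges are two-element vertex sets; the values of [label] outside [edges] are
   irrelevant. *)
Record eograph (R : realType) (V : finType) := EOGraph {
  edges : {set {set V}};
  label : {set V} -> R;
  card_edge : {in edges, forall e : {set V}, #|e| = 2%N};
  label_inj : {in edges &, injective label} }.

(* [f] is an order-respecting isomorphism from [G] onto a subgraph of [H] carrying
   the induced order; the copies of [G] in [H] are the images of such maps. *)
Definition embedding (R : realType) (U V : finType)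
    (G : eograph R U) (H : eograph R V) (f : U -> V) : Prop :=
  [/\ injective f,
      {in edges G, forall e : {set U}, f @: e \in edges H} &
      {in edges G &, forall e1 e2 : {set U},
        (label H (f @: e1) < label H (f @: e2)) = (label G e1 < label G e2)}].

Definition contains (R : realType) (U V : finType)
    (H : eograph R V) (G : eograph R U) : Prop :=
  exists f : U -> V, embedding G H f.

Definition eo_free (R : realType) (U V : finType)
    (G : eograph R U) (H : eograph R V) : Prop := ~ contains H G.

Section AddFirst.
Variables (R : realType) (V : finType) (H : eograph R V).
Variables (e : {set V}) (r : R).
Hypothesis e2 : #|e| = 2%N.
Hypothesis r_first : {in edges H, forall e' : {set V}, r < label H e'}.

Let add_label (e' : {set V}) : R := if e' == e then r else label H e'.

Let add_card_edge : {in e |: edges H, forall e' : {set V}, #|e'| = 2%N}.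
Proof. by move=> e' /setU1P[-> //|]; exact: card_edge. Qed.

Let add_label_inj : {in e |: edges H &, injective add_label}.
Proof.
move=> e1 e3; rewrite !in_setU1 /add_label.
case: eqVneq => [-> _|_ /= He1]; case: eqVneq => [-> // _|_ /= He3] //=.
- by move=> req; move: (r_first He3); rewrite req ltxx.
- by move=> req; move: (r_first He1); rewrite req ltxx.
- exact: label_inj.
Qed.

Definition add_first : eograph R V := EOGraph add_card_edge add_label_inj.

End AddFirst.

(* The choice of the smallest label [r] does not affect the edge-order. *)
Definition semisaturated (R : realType) (U V : finType)
    (G : eograph R U) (H : eograph R V) : Prop :=
  forall (e : {set V}) (e2 : #|e| = 2%N), e \notin edges H ->
  forall (r : R) (r_first : {in edges H, forall e' : {set V}, r < label H e'}),
  exists2 f : U -> V, embedding G (add_first e2 r_first) f &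
    exists2 e' : {set U}, e' \in edges G & f @: e' = e.

Definition saturated (R : realType) (U V : finType)
    (G : eograph R U) (H : eograph R V) : Prop :=
  eo_free G H /\ semisaturated G H.

(* Minimum of a set of naturals; 0 if the set is empty, which is never the case
   in [ssat_m n G], nor in [sat_m n G] when [G] has an edge: see
   [semisaturated_ex] and [saturated_ex]. *)
Definition min_nat (A : set nat) : nat :=
  xget 0%N [set k | A k /\ forall j, A j -> (k <= j)%N].

Definition ssat_m (R : realType) (n : nat) (U : finType) (G : eograph R U) : nat :=
  min_nat [set #|edges H| | H in [set H : eograph R 'I_n | semisaturated G H]].

Definition sat_m (R : realType) (n : nat) (U : finType) (G : eograph R U) : nat :=
  min_nat [set #|edges H| | H in [set H : eograph R 'I_n | saturated G H]].

Lemma min_natP (A : set nat) : A !=set0 ->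
  A (min_nat A) /\ forall j, A j -> (min_nat A <= j)%N.
Proof.
move=> [k Ak].
suff ex : exists m, [set k | A k /\ forall j, A j -> (k <= j)%N] m.
  exact: (xgetPex 0%N ex).
have exA : exists m, `[< A m >] by exists k; apply/asboolP.
case: (ex_minnP exA) => m /asboolP Am minm.
by exists m; split=> // j Aj; apply: minm; apply/asboolP.
Qed.

Lemma first_label_ex (R : realType) (V : finType) (H : eograph R V) :
  exists r : R, {in edges H, forall e' : {set V}, r < label H e'}.
Proof.
exists (- (1 + \sum_(e in edges H) `|label H e|)) => e' He'.
rewrite ltrNl (le_lt_trans (ler_norm _))// normrN (bigD1 e')//=.
by rewrite addrCA ltrDl ltr_pwDl// sumr_ge0.
Qed.

Section Existence.
Variables (R : realType) (U : finType) (G : eograph R U).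

Let complete_label (V : finType) (e : {set V}) : R := (enum_rank e)%:R.

Let complete_card (V : finType) :
  {in [set e : {set V} | #|e| == 2%N]%SET, forall e : {set V}, #|e| = 2%N}.
Proof. by move=> e; rewrite inE => /eqP. Qed.

Let complete_inj (V : finType) :
  {in [set e : {set V} | #|e| == 2%N]%SET &, injective (@complete_label V)}.
Proof.
move=> e1 e2 _ _ /eqP; rewrite /complete_label eqr_nat => /eqP h.
exact/enum_rank_inj/val_inj.
Qed.

Lemma semisaturated_ex (V : finType) : exists H : eograph R V, semisaturated G H.
Proof.
exists (EOGraph (@complete_card V) (@complete_inj V)) => e e2.
by rewrite inE e2.
Qed.

Let empty_card (V : finType) :
  {in (finset.set0 : {set {set V}}), forall e : {set V}, #|e| = 2%N}.
Proof. by move=> e; rewrite inE. Qed.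

Let empty_inj (V : finType) :
  {in (finset.set0 : {set {set V}}) &, injective (@complete_label V)}.
Proof. by move=> e; rewrite inE. Qed.

Lemma saturated_ex (V : finType) : edges G != finset.set0 ->
  exists H : eograph R V, saturated G H.
Proof.
case/set0Pn => g Gg.
suff main m (H : eograph R V) : eo_free G H ->
    (#|~: edges H| <= m)%N -> exists H : eograph R V, saturated G H.
  apply: (main _ (EOGraph (@empty_card V) (@empty_inj V)) _ (leqnn _)).
  by case=> f [_ /(_ _ Gg)]; rewrite inE.
elim: m H => [|m IHm] H freeH leHm.
  exists H; split=> // e e2 eH; exfalso; move: leHm.
  by rewrite leqn0 cards_eq0 => /eqP/setP/(_ e); rewrite !inE eH.
have [satH|nsatH] := pselect (semisaturated G H); first by exists H.
have [e [e2 [eH [r [r_first nocopy]]]]] : exists (e : {set V})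
    (e2 : #|e| = 2%N), e \notin edges H /\
    exists (r : R) (r_first : {in edges H, forall e', r < label H e'}),
    ~ exists2 f : U -> V, embedding G (add_first e2 r_first) f &
        exists2 e' : {set U}, e' \in edges G & f @: e' = e.
  apply: contrapT => h; apply: nsatH => e e2 eH r r_first.
  by apply: contrapT => nof; apply: h; exists e, e2; split=> //; exists r, r_first.
apply: (IHm (add_first e2 r_first)).
- case=> f emb; apply: nocopy; exists f => //.
  apply: contrapT => note; apply: freeH; exists f.
  have neqe e' : e' \in edges G -> (f @: e' == e) = false.
    by move=> Ge'; apply/eqP => fe'; apply: note; exists e'.
  case: emb => injf sub mono; split=> //.
  + by move=> e' Ge'; move: (sub _ Ge'); rewrite in_setU1 neqe.
  + by move=> e1 e3 G1 G3; move: (mono _ _ G1 G3); rewrite /= !neqe.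
- rewrite -ltnS; apply: leq_trans leHm; apply: proper_card.
  rewrite properE finset.setCS finset.subsetUr /=; apply/subsetPn; exists e; rewrite !inE ?eqxx//.
Qed.

End Existence.

Section D0.
Variable R : realType.
Let a : 'I_4 := @Ordinal 4 0 isT.
Let b : 'I_4 := @Ordinal 4 1 isT.
Let v : 'I_4 := @Ordinal 4 2 isT.
Let w : 'I_4 := @Ordinal 4 3 isT.

(* Listed in increasing edge-order. *)
Definition D0_edges : seq {set 'I_4} :=
  [:: [set a; b]; [set a; v]; [set a; w]; [set b; w]; [set b; v]]%SET.

Let D0_label (e : {set 'I_4}) : R := (index e D0_edges)%:R.

Let D0_card : {in [set e in D0_edges]%SET, forall e : {set 'I_4}, #|e| = 2%N}.
Proof.
by move=> e; rewrite !inE => /or4P[||| /orP[]] /eqP ->; rewrite cards2.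
Qed.

Let D0_inj : {in [set e in D0_edges]%SET &, injective D0_label}.
Proof.
move=> e1 e2; rewrite !finset.in_set => h1 h2 /eqP; rewrite eqr_nat => /eqP heq.
by rewrite -(nth_index finset.set0 h1) heq nth_index.
Qed.

Definition D0 : eograph R 'I_4 := EOGraph D0_card D0_inj.

End D0.

(* Main.v *)
(* Idea. Let [B] be a set of [k] vertices with [n <= k!], order the complete
   bipartite graph between [~: B] and [B] vertex by vertex of [~: B], and order
   the edges at each [x] outside [B] by its own permutation of [B]. For distinct
   [x], [y] outside [B], [x] before [y], the two permutations differ, so some
   [v], [w] in [B] satisfy [xv < xw < yw < yv]: a first edge [xy] closes a copy
   of [D0]. The bipartite graph has no triangle, hence is [D0]-free, and a
   saturated graph obtained from it by adding first edges has only edges meeting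
   [B], at most [k n] of them. The least [k] with [n <= k!] is
   [O(ln n / ln ln n)]. *)
Require Import Defs.
From mathcomp Require Import fingroup perm lra.

Set Implicit Arguments.
Unset Strict Implicit.
Unset Printing Implicit Defensive.

Local Open Scope classical_set_scope.
Local Open Scope ring_scope.

(** * Saturating a graph by insertions at the front of the edge-order *)

(** The invariant kept while edges are inserted at the front one after another; the order among the
    new edges is left open. *)
Definition front_extension (R : realType) (V : finType) (H H' : eograph R V) :=
  [/\ edges H \subset edges H',
      {in edges H, forall e : {set V}, label H' e = label H e} &
      {in edges H' & edges H, forall e e' : {set V}, e \notin edges H ->
        label H' e < label H' e'}].

Lemma front_extension_refl (R : realType) (V : finType) (H : eograph R V) :
  front_extension H H.
Proof. by split=> // e e' ->. Qed.

Lemma front_extension_add (R : realType) (V : finType) (H H' : eograph R V)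
    (e : {set V}) (e2 : #|e| = 2%N) (r : R)
    (r_first : {in edges H', forall e' : {set V}, r < label H' e'}) :
  e \notin edges H' -> front_extension H H' ->
  front_extension H (add_first e2 r_first).
Proof.
move=> eH' [sub lab lt_new].
have neq e' : e' \in edges H' -> (e' == e) = false.
  by move=> H'e'; apply/eqP => ee'; rewrite -ee' H'e' in eH'.
split=> /=.
- by rewrite (fintype.subset_trans sub)// finset.subsetUr.
- by move=> e' He' /=; rewrite neq ?lab// (fintype.subsetP sub).
- move=> e1 e3 /setU1P[->|He1] He3 nHe1; have H'e3 := fintype.subsetP sub _ He3.
  + by rewrite eqxx neq// r_first.
  + by rewrite !neq// lt_new.
Qed.

(** A copy in the enlarged graph that avoids [e] is already a copy in [H], since the other labels
    are unchanged. *)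
Lemma eo_free_add (R : realType) (U V : finType) (G : eograph R U)
    (H : eograph R V) (e : {set V}) (e2 : #|e| = 2%N) (r : R)
    (r_first : {in edges H, forall e' : {set V}, r < label H e'}) :
  eo_free G H ->
  ~ (exists2 f : U -> V, embedding G (add_first e2 r_first) f &
      exists2 e' : {set U}, e' \in edges G & f @: e' = e) ->
  eo_free G (add_first e2 r_first).
Proof.
move=> freeH nocopy [f emb]; apply: nocopy; exists f => //.
apply: contrapT => note; apply: freeH; exists f.
have neqe e' : e' \in edges G -> (f @: e' == e) = false.
  by move=> Ge'; apply/eqP => fe'; apply: note; exists e'.
case: emb => injf sub mono; split=> //.
- by move=> e' Ge'; move: (sub _ Ge'); rewrite in_setU1 neqe.
- by move=> e1 e3 G1 G3; move: (mono _ _ G1 G3); rewrite /= !neqe.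
Qed.

(** Greedy: while the graph is not semisaturated, some missing edge can be put first without closing
    a copy. The induction is on a bound [m] for the number of vertex sets that are not edges. *)
Lemma saturated_front_extension (R : realType) (U V : finType)
    (G : eograph R U) (H : eograph R V) : eo_free G H ->
  exists2 H' : eograph R V, saturated G H' & front_extension H H'.
Proof.
suff main m (H' : eograph R V) : eo_free G H' -> front_extension H H' ->
    (#|~: edges H'| <= m)%N ->
    exists2 H' : eograph R V, saturated G H' & front_extension H H'.
  by move=> freeH; exact: (main _ H freeH (front_extension_refl H) (leqnn _)).
elim: m H' => [|m IHm] H' freeH' ext leH'm.
  exists H' => //; split=> // e e2 eH'; exfalso; move: leH'm.
  by rewrite leqn0 cards_eq0 => /eqP/setP/(_ e); rewrite !inE eH'.
have [satH'|nsatH'] := pselect (semisaturated G H'); first by exists H'.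
apply: contrapT => none; apply: nsatH' => e e2 eH' r r_first.
apply: contrapT => nocopy; apply: none; apply: (IHm (add_first e2 r_first)).
- exact: eo_free_add.
- exact: front_extension_add.
- rewrite -ltnS; apply: leq_trans leH'm; apply: proper_card.
  rewrite properE finset.setCS finset.subsetUr /=.
  by apply/subsetPn; exists e; rewrite !inE ?eqxx.
Qed.

(** * Presence and absence of [D0] *)

(** Both [es] and [D0_edges] list the edges in increasing order, so comparing labels amounts to
    comparing positions. *)
Lemma contains_D0 (R : realType) (V : finType) (H : eograph R V) (a b v w : V) :
  let es := [:: [set a; b]; [set a; v]; [set a; w]; [set b; w]; [set b; v]]%SET in
  uniq [:: a; b; v; w] -> {subset es <= edges H} ->
  sorted <%R [seq label H e | e <- es] -> contains H (D0 R).
Proof.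
move=> es uniq_abvw esH sorted_es.
pose f (i : 'I_4) := nth a [:: a; b; v; w] i.
have f_nth e : e \in D0_edges ->
    f @: e = nth finset.set0 es (index e D0_edges).
  move=> De; rewrite -[in LHS](nth_index finset.set0 De).
  move: De; rewrite -index_mem; case: (index _ _) => [|[|[|[|[|i]]]]]//= _;
  by rewrite finset.imsetU !imset_set1.
have D0E e : e \in edges (D0 R) -> e \in D0_edges by rewrite finset.in_set.
exists f; split.
- by move=> i j /eqP; rewrite /f nth_uniq// => /eqP/val_inj.
- move=> e /D0E eD0; rewrite f_nth// esH// mem_nth//.
  by move: eD0; rewrite -index_mem.
- move=> e1 e2 /D0E D1 /D0E D2; rewrite !f_nth//.
  have lt1 : (index e1 D0_edges < size es)%N by move: D1; rewrite -index_mem.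
  have lt2 : (index e2 D0_edges < size es)%N by move: D2; rewrite -index_mem.
  rewrite -!(nth_map _ (0 : R) (label H))//.
  rewrite [LHS](lt_sorted_ltn_nth 0 sorted_es) ?inE ?size_map//.
  by rewrite /= ltr_nat.
Qed.

(** The vertices [a], [b], [v] form a triangle in [D0], and two of them would fall on the same side
    of the bipartition. *)
Lemma bipartite_D0_free (R : realType) (V : finType) (H : eograph R V)
    (B : {set V}) :
  (forall x y, [set x; y]%SET \in edges H -> (x \in B) != (y \in B)) ->
  eo_free (D0 R) H.
Proof.
move=> bip [f [_ sub _]].
have mem i j : [set i; j]%SET \in D0_edges -> (f i \in B) != (f j \in B).
  move=> ij; apply: bip; have := sub [set i; j]%SET.
  by rewrite finset.imsetU !imset_set1; apply; rewrite finset.in_set.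
have := mem (@Ordinal 4 0 isT) (@Ordinal 4 1 isT).
have := mem (@Ordinal 4 0 isT) (@Ordinal 4 2 isT).
have := mem (@Ordinal 4 1 isT) (@Ordinal 4 2 isT).
rewrite /D0_edges !in_cons !eqxx ?orbT.
by case: (f _ \in B); case: (f _ \in B); case: (f _ \in B) => /= h1 h2 h3;
  (have := h1 isT; have := h2 isT; have := h3 isT).
Qed.

(** * Labelled bipartite graphs and inversions of permutations *)

Lemma bipartite_eograph (R : realType) (V : finType) (B : {set V})
    (lab : V -> V -> R) :
  (forall x y b c, x \notin B -> y \notin B -> b \in B -> c \in B ->
    lab x b = lab y c -> x = y /\ b = c) ->
  exists H : eograph R V,
    [/\ forall x b, x \notin B -> b \in B -> [set x; b]%SET \in edges H,
        forall x b, x \notin B -> b \in B -> label H [set x; b]%SET = lab x b &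
        forall x y, [set x; y]%SET \in edges H -> (x \in B) != (y \in B)].
Proof.
move=> lab_inj.
pose E := [set [set p.1; p.2]%SET | p in finset.setX (~: B) B]%SET.
(* The ends of an edge are told apart by membership in [B]; the default [0] occurs only off the
   edges. *)
pose l (e : {set V}) : R :=
  if [pick p | [&& p.1 \notin B, p.2 \in B & e == [set p.1; p.2]%SET]]
  is Some p then lab p.1 p.2 else 0.
have set2_inj x y b c : x \notin B -> y \notin B -> b \in B -> c \in B ->
    [set x; b]%SET = [set y; c]%SET -> x = y /\ b = c.
  move=> xB yB bB cB /setP eq2; split.
    have := eq2 x; rewrite !inE eqxx /= => /esym/orP[/eqP//|/eqP xc].
    by rewrite xc cB in xB.
  have := eq2 b; rewrite !inE eqxx orbT => /esym/orP[/eqP by_|/eqP//].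
  by rewrite -by_ bB in yB.
have lE x b : x \notin B -> b \in B -> l [set x; b]%SET = lab x b.
  move=> xB bB; rewrite /l; case: pickP => [[y c] /= /and3P[yB cB /eqP eq2]|].
    by have [-> ->] := set2_inj _ _ _ _ xB yB bB cB eq2.
  by move/(_ (x, b)); rewrite /= xB bB eqxx.
have EP e : e \in E -> exists x b, [/\ x \notin B, b \in B & e = [set x; b]%SET].
  case/imsetP => -[x b]; rewrite inE /= inE => /andP[xB bB] ->.
  by exists x, b.
have E_card : {in E, forall e : {set V}, #|e| = 2%N}.
  move=> e /EP[x [b [xB bB ->]]]; rewrite cards2.
  by case: eqVneq => // xb; rewrite xb bB in xB.
have l_inj : {in E &, injective l}.
  move=> e e' /EP[x [b [xB bB ->]]] /EP[y [c [yB cB ->]]]; rewrite !lE//.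
  by case/lab_inj => // -> ->.
exists (EOGraph E_card l_inj); split=> //= [x b xB bB|x y /EP[z [b [zB bB]]]].
  by apply/imsetP; exists (x, b); rewrite ?inE //= xB bB.
move=> /setP eq2.
have := eq2 b; have := eq2 z; have := eq2 x; have := eq2 y.
rewrite !inE !eqxx /= !orbT => /esym/orP yzb /esym/orP xzb.
have zb : (z == b) = false by apply/eqP => zb; rewrite zb bB in zB.
case: xzb => /eqP -> ; case: yzb => /eqP ->; rewrite ?bB ?(negbTE zB)//.
  by rewrite orbb eq_sym zb.
by rewrite orbb zb.
Qed.

(* Otherwise [v |-> s v] and [v |-> t v] would induce the same order on [B], and
   a permutation of [B] is determined by the ranks of its values. *)
Lemma perm_on_inversion (V : finType) (B : {set V}) (r : V -> nat)
    (s t : {perm V}) :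
  injective r -> perm_on B s -> perm_on B t -> s != t ->
  exists v w,
    [/\ v \in B, w \in B, (r (s v) < r (s w))%N & (r (t w) < r (t v))%N].
Proof.
move=> r_inj sB tB /negP nst; apply: contrapT => noinv; apply: nst.
(* The elements of [B] below [p v] can be counted through [p], which permutes [B]. *)
have card_below (p : {perm V}) v : perm_on B p ->
    #|[set w in B | (r (p w) < r (p v))%N]%SET| =
    #|[set w in B | (r w < r (p v))%N]%SET|.
  move=> pB; rewrite -(card_imset _ (@perm_inj _ p)); apply: eq_card => w.
  apply/imsetP/idP => [[u]|]; rewrite !inE.
    by move=> /andP[uB lt_u] ->; rewrite perm_closed// uB.
  move=> /andP[wB lt_w]; exists (p^-1%g w); last by rewrite permKV.
  by rewrite !inE permKV lt_w -(perm_closed _ pB) permKV wB.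
(* Without such an inversion, whatever [p] sends below [p v] is sent by [q] below [q v], so [p v]
   has at most as many elements of [B] below it as [q v]. *)
have le (p q : {perm V}) v : perm_on B p -> perm_on B q -> v \in B ->
    (forall u w, u \in B -> w \in B ->
      (r (p u) < r (p w))%N -> (r (q w) < r (q u))%N -> False) ->
    (r (p v) <= r (q v))%N.
  move=> pB qB vB noinv_pq; rewrite leqNgt; apply/negP => lt_v.
  have : (#|[set w in B | (r w < r (p v))%N]%SET| <=
          #|[set w in B | (r w < r (q v))%N]%SET|)%N.
    rewrite -!card_below//; apply: subset_leq_card; apply/fintype.subsetP => w.
    rewrite !inE => /andP[wB lt_w]; rewrite wB /= ltnNge leq_eqVlt.
    apply/negP => /orP[/eqP/r_inj/perm_inj vw|]; last exact: noinv_pq.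
    by rewrite vw ltnn in lt_w.
  rewrite leqNgt => /negP; apply; apply: proper_card; apply/properP; split.
    apply/fintype.subsetP => w; rewrite !inE => /andP[-> /=] lt_w.
    exact: ltn_trans lt_v.
  by exists (q v); rewrite !inE ?perm_closed// ?vB ?lt_v ?ltnn.
apply/eqP/permP => v; have [vB|vB] := boolP (v \in B); last first.
  by rewrite (out_perm sB)// (out_perm tB).
apply/r_inj/eqP; rewrite eqn_leq !le// => u w uB wB lt1 lt2; apply: noinv.
  by exists w, u.
by exists u, w.
Qed.

(** * The saturated graph and the resulting bound on [sat_m] *)

Lemma saturated_D0_small (R : realType) (V : finType) (B : {set V}) :
  (#|V| <= (#|B|)`!)%N ->
  exists2 H : eograph R V, saturated (D0 R) H & (#|edges H| <= #|B| * #|V|)%N.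
Proof.
rewrite -card_perm => leVB.
have [s [s_inj sB]] : exists s : V -> {perm V},
    injective s /\ forall x, perm_on B (s x).
  exists (fun x => enum_val (widen_ord leVB (enum_rank x))); split=> [x y|x].
    by move=> /enum_val_inj/(congr1 val)/= /val_inj/enum_rank_inj.
  exact: (enum_valP (widen_ord leVB (enum_rank x))).
pose r (x : V) : nat := enum_rank x.
have r_inj : injective r by move=> x y xy; apply: enum_rank_inj; exact: ord_inj.
have r_lt x : (r x < #|V|)%N by exact: ltn_ord.
(* Base-[#|V|] digits: [x] is the leading one, its permutation breaks ties. *)
pose lab (x b : V) : R := (r x * #|V| + r (s x b))%:R.
have [|H [HE Hl Hbip]] := @bipartite_eograph R V B lab.
  move=> x y b c _ _ _ _ /eqP; rewrite eqr_nat => /eqP eq_lab.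
  have V0 : (0 < #|V|)%N by apply: leq_trans (r_lt x).
  have xy : x = y.
    apply: r_inj; have := congr1 (divn^~ #|V|) eq_lab.
    by rewrite !divnMDl// !divn_small// !addn0.
  split=> //; subst y; move/addnI: eq_lab => /r_inj; exact: perm_inj.
have [H' satH' [sub lab' lt_new]] :=
  saturated_front_extension (bipartite_D0_free Hbip).
exists H' => //.
(* An edge between two vertices outside [B] would be new, hence precede all of [H], and play [ab] in
   a copy of [D0]. *)
have noA x y : x \notin B -> y \notin B -> x != y ->
    [set x; y]%SET \notin edges H'.
  (* In [D0] the edge [aw] precedes [bw], so the earlier vertex must play [a]. *)
  wlog lt_xy : x y / (r x < r y)%N.
    move=> wl xB yB xy; case: (ltngtP (r x) (r y)) => [lt|lt|/r_inj].
    - exact: wl.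
    - by rewrite finset.setUC wl// eq_sym.
    - by move/eqP; rewrite (negbTE xy).
  move=> xB yB xy; apply/negP => H'xy; case: satH' => freeH' _; apply: freeH'.
  have [|v [w [vB wB lt1 lt2]]] :=
    @perm_on_inversion V B r (s x) (s y) r_inj (sB x) (sB y).
    by apply: contra xy => /eqP/s_inj ->.
  have nH : [set x; y]%SET \notin edges H.
    by apply/negP => /Hbip; rewrite (negbTE xB) (negbTE yB).
  have H'E z b : z \notin B -> b \in B -> [set z; b]%SET \in edges H'.
    by move=> zB bB; apply: (fintype.subsetP sub); exact: HE.
  have H'l z b : z \notin B -> b \in B -> label H' [set z; b]%SET = lab z b.
    by move=> zB bB; rewrite lab' ?Hl ?HE.
  have neqB z b : z \notin B -> b \in B -> (z == b) = false.
    by move=> zB bB; apply/eqP => zb; rewrite zb bB in zB.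
  apply: (@contains_D0 _ _ _ x y v w).
  - rewrite /= !inE (neqB x v)// (neqB x w)// (neqB y v)// (neqB y w)//
      (negbTE xy) andbT /=.
    by apply/eqP => vw; rewrite vw ltnn in lt1.
  - move=> e; rewrite !inE => /or4P[||| /orP[]] /eqP -> //; exact: H'E.
  - have lt_e : label H' [set x; y]%SET < label H' [set x; v]%SET.
      by apply: lt_new => //; exact: HE.
    rewrite /= lt_e !H'l// !ltr_nat !ltn_add2l lt1 lt2 !andbT /=.
    (* This threshold separates the labels at [x] from those at the later vertex [y]. *)
    rewrite (@leq_trans ((r x).+1 * #|V|))//; last first.
      by rewrite (leq_trans (leq_mul lt_xy (leqnn _))) ?leq_addr.
    by rewrite mulSn addnC ltn_add2r.
have : edges H' \subset [set [set p.1; p.2]%SET | p in finset.setX B [set: V]]%SET.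
  apply/fintype.subsetP => e He; have /eqP/cards2P[x [y [xy eE]]] := card_edge He.
  rewrite {}eE in He *; have [xB|xB] := boolP (x \in B).
    by apply/imsetP; exists (x, y); rewrite // !inE xB.
  have [yB|yB] := boolP (y \in B).
    by rewrite finset.setUC; apply/imsetP; exists (y, x); rewrite // !inE yB.
  by rewrite (negbTE (noA _ _ xB yB xy)) in He.
move/subset_leq_card/leq_trans; apply.
by rewrite (leq_trans (leq_imset_card _ _))// cardsX cardsT.
Qed.

Lemma sat_m_D0_le (R : realType) (n k : nat) :
  (k <= n)%N -> (n <= k`!)%N -> (sat_m n (D0 R) <= k * n)%N.
Proof.
move=> le_kn le_nk.
pose B := (widen_ord le_kn @: [set: 'I_k])%SET.
have cardB : #|B| = k.
  by rewrite card_imset ?cardsT ?card_ord// => i j /(congr1 val)/= /val_inj.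
have [|H satH] := @saturated_D0_small R 'I_n B; first by rewrite card_ord cardB.
rewrite cardB card_ord; apply: leq_trans.
set A := [set #|edges H| | H in [set H : eograph R 'I_n | saturated (D0 R) H]].
have AH : A #|edges H| by exists H.
by have [_] := @min_natP A (ex_intro _ _ AH); apply.
Qed.

(** A minimal saturated graph is semisaturated. Since [G] has an edge, a saturated graph exists and
    [sat_m] is not the default value of [min_nat]. *)
Lemma ssat_m_le_sat_m (R : realType) (U : finType) (G : eograph R U) (n : nat) :
  edges G != finset.set0 -> (ssat_m n G <= sat_m n G)%N.
Proof.
move=> G0.
set A := [set #|edges H| | H in [set H : eograph R 'I_n | semisaturated G H]].
set A' := [set #|edges H| | H in [set H : eograph R 'I_n | saturated G H]].
have [H satH] := saturated_ex 'I_n G0.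
have A'H : A' #|edges H| by exists H.
have [[H' [_ semiH'] cardH'] _] := @min_natP A' (ex_intro _ _ A'H).
rewrite /sat_m -/A' -cardH'.
have AH' : A #|edges H'| by exists H'.
by have [_] := @min_natP A (ex_intro _ _ AH'); apply.
Qed.

(** * Growth of the factorial and the asymptotic bound *)

(** The top [h] factors of the factorial of [2h] are all at least [h]. *)
Lemma expnn_le_fact_double (h : nat) : (h ^ h <= h.*2`!)%N.
Proof.
suff le : forall j, (h ^ j * h`! <= (h + j)`!)%N.
  by rewrite -addnn (leq_trans _ (le h))// leq_pmulr// fact_gt0.
elim=> [|j IHj]; first by rewrite addn0 mul1n.
by rewrite addnS factS expnS -mulnA leq_mul// -addnS leq_addr.
Qed.

Lemma nat_le_fact (n : nat) : (n <= n`!)%N.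
Proof. by case: n => // n; rewrite factS leq_pmulr// fact_gt0. Qed.

Lemma expnn_lt_ln_bound (R : realType) (n h : nat) :
  1 < ln n%:R :> R -> (h ^ h < n)%N ->
  h%:R <= 2 * (ln n%:R / ln (ln n%:R)) :> R.
Proof.
set L : R := ln n%:R => L1 lt_hn.
have L0 : 0 < L by apply: lt_trans L1.
have lnL0 : 0 < ln L by exact: ln_gt0.
rewrite mulrA ler_pdivlMr//.
have s0 : 0 < Num.sqrt L by rewrite sqrtr_gt0.
have lnLE : ln L = ln (Num.sqrt L) *+ 2.
  by rewrite -lnXn// sqr_sqrtr// ltW.
have lns := ln_sublinear s0.
(* Either [h <= sqrt L], or [ln h > ln L / 2] while [h * ln h < L]. *)
have [le_hs|lt_sh] := leP (h%:R : R) (Num.sqrt L).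
  (* Here [ln L] is twice the logarithm of [sqrt L], hence at most [2 * sqrt L]. *)
  have : h%:R * ln L <= Num.sqrt L * (2 * Num.sqrt L).
    rewrite ler_pM ?ler0n ?(ltW lnL0)// lnLE.
    by rewrite -[ln _ *+ 2]mulr_natl ler_pM2l// ltW.
  by rewrite mulrCA -expr2 sqr_sqrtr ?(ltW L0).
have h0 : 0 < h%:R :> R by apply: lt_trans lt_sh.
have n0 : 0 < n%:R :> R by rewrite ltr0n (leq_trans _ lt_hn).
have : ln (h%:R ^+ h) < L.
  by rewrite /L ltr_ln ?posrE ?exprn_gt0// -natrX ltr_nat.
rewrite lnXn// -[ln _ *+ _]mulr_natl => lt_hL.
have : ln (Num.sqrt L) < ln h%:R by rewrite ltr_ln ?posrE.
move=> /ltW /(ler_wpM2l (ltW h0)) le_h.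
rewrite lnLE -[ln _ *+ 2]mulr_natl mulrCA ler_pM2l//.
exact: le_trans le_h (ltW lt_hL).
Qed.

Theorem theorem23 (R : realType) :
  (forall n : nat, (ssat_m n (D0 R) <= sat_m n (D0 R))%N) /\
  (fun n : nat => (sat_m n (D0 R))%:R : R^o) =O_\oo
    (fun n : nat => n%:R * (ln n%:R / ln (ln n%:R)) : R^o).
Proof.
split=> [n|].
  apply: ssat_m_le_sat_m; apply/set0Pn.
  by exists (head finset.set0 D0_edges); rewrite finset.in_set mem_head.
(* With [Q] the quotient of logarithms, the end of the proof has [k <= 2h + 2], [h <= 2Q] and
   [1 <= Q], so [k <= 4Q + 2 <= 6Q]. *)
apply/eqO_exP; exists 6 => //.
near=> n.
have n_large : expR 1 < n%:R :> R by near: n; exact: nbhs_infty_gtr.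
have n0 : 0 < n%:R :> R by apply: lt_trans n_large; exact: expR_gt0.
have L1 : 1 < ln n%:R :> R.
  by rewrite -[X in X < _](expRK (R := R)) ltr_ln ?posrE ?expR_gt0.
have lnL0 := ln_gt0 L1.
have ex_k : exists k, (n <= k`!)%N by exists n; exact: nat_le_fact.
case: (ex_minnP ex_k) => k le_nk min_k.
(* Ensures that [k] vertices are available for [B]. *)
have le_kn := min_k _ (nat_le_fact n).
have leq_sat := sat_m_D0_le R le_kn le_nk.
have Q1 : 1 <= ln n%:R / ln (ln n%:R) :> R.
  by rewrite ler_pdivlMr// mul1r ltW// ln_sublinear// (lt_trans _ L1).
rewrite ger0_norm// ger0_norm; last by rewrite mulr_ge0// (le_trans _ Q1).
apply: (@le_trans _ _ (k * n)%:R); first by rewrite ler_nat.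
rewrite natrM mulrCA mulrC ler_pM2l//.
have [->|k0] := posnP k; first by rewrite mulr_ge0// (le_trans _ Q1).
(* Then [2h < k], so by minimality of [k] the factorial of [2h] is below [n]. *)
pose h := (k.-1)./2.
have le_kh : (k <= h.*2.+2)%N.
  rewrite -(prednK k0) ltnS -{1}(odd_double_half k.-1).
  by rewrite -add1n leq_add2r leq_b1.
have lt_hn : (h ^ h < n)%N.
  apply: leq_ltn_trans (expnn_le_fact_double h) _.
  rewrite ltnNge; apply/negP => /min_k; apply/negP; rewrite -ltnNge.
  rewrite -[X in (_ < X)%N](prednK k0) ltnS.
  by rewrite -(odd_double_half k.-1) leq_addl.
have := expnn_lt_ln_bound L1 lt_hn.
set Q := ln n%:R / ln _ in Q1 * => le_h.
apply: (@le_trans _ _ (h.*2.+2)%:R); first by rewrite ler_nat.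
have -> : (h.*2.+2)%:R = 2 * h%:R + 2 :> R.
  by rewrite -mul2n -addn2 natrD natrM.
lra.
Unshelve. all: by end_near.
Qed.
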